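(* Let $t>0$ be a real number and let $M=(X,d)$ be a metric space. Then $M$ is separable if and only if the gravitational metric space $M_t=(X,d_t)$ is separable.
   Context: For a metric space $M=(X,d)$ and a real number $t>0$, the gravitational metric space $M_t=(X,d_t)$ is the set $X$ equipped with the metric $d_t(x,y)=\min\{2t,d(x,y)\}$ for all $x,y\in X$. A metric space is separable if it has a countable dense subset. *)

(* Defs.v *)
From HB Require Import structures.
From mathcomp Require Import all_boot all_order all_algebra.
From mathcomp Require Import all_classical all_reals all_analysis.

Set Implicit Arguments.
Unset Strict Implicit.
Unset Printing Implicit Defensive.

Import Order.TTheory GRing.Theory Num.Theory.

Local Open Scope classical_set_scope.
Local Open Scope ring_scope.

Definition separable (T : topologicalType) : Prop :=
  exists2 D : set T, countable D & dense D.

(* An alias of the carrier of M, so that it can bear a second metric structure,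
   whose topology is generated by that metric and not copied from M. *)
Definition gravitational (R : realType) (t : R) (t0 : 0 < t)
  (M : metricType R) : Type := M.

Definition gravitational_dist (R : realType) (t : R) (M : metricType R)
  (x y : M) : R := Num.min (2 * t) (mdist x y).

Section gravitational_metric.
Context (R : realType) (t : R) (t0 : 0 < t) (M : metricType R).

Local Notation Mt := (gravitational t0 M).
Local Notation dt := (@gravitational_dist R t M).

Let t2_gt0 : 0 < 2 * t. Proof. by rewrite mulr_gt0. Qed.

Let dt_xx x : dt x x = 0.
Proof. by rewrite /gravitational_dist mdistxx min_r // ltW. Qed.

Let dt_positivity x y : dt x y = 0 -> x = y.
Proof.
rewrite /gravitational_dist; case: leP => [_ t2_eq0|_]; last first.
  exact: mdist_positivity.
by move: t2_gt0; rewrite t2_eq0 ltxx.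
Qed.

Let dt_sym x y : dt x y = dt y x.
Proof. by rewrite /gravitational_dist metric_sym. Qed.

Let dt_triangle y x z : dt x z <= dt x y + dt y z.
Proof.
rewrite /gravitational_dist ge_min.
have t2_ge0 := ltW t2_gt0.
case: (leP (2 * t) (mdist x y)) => _.
  by rewrite lerDl le_min t2_ge0 mdist_ge0.
case: (leP (2 * t) (mdist y z)) => _.
  by rewrite lerDr mdist_ge0.
by rewrite metric_triangle orbT.
Qed.

HB.instance Definition _ := Choice.copy Mt M.

HB.instance Definition _ :=
  isMetric.Build R Mt dt_xx dt_positivity dt_sym dt_triangle.

Lemma gravitational_mdistE (x y : Mt) :
  mdist x y = Num.min (2 * t) (mdist (x : M) (y : M)).
Proof. by []. Qed.

End gravitational_metric.

(* Main.v *)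
Require Import Defs.
From mathcomp Require Import all_boot all_order all_algebra.
From mathcomp Require Import all_classical all_reals all_analysis.

(** Separability depends on the topology alone, and truncating a metric at a
positive level does not change the topology: the balls of radius at most [2 * t]
are the same for [d] and for [min (2 * t) d], and every neighbourhood of a point
contains such a small ball. Hence the two metrics have the same neighbourhoods
([gravitational_nbhs]), so the same open sets, so the same dense sets; since
countability refers only to the underlying set, a countable dense set for one
metric is a countable dense set for the other. *)

Import metricType_numDomainType.
Import Order.TTheory GRing.Theory Num.Theory.

Local Open Scope classical_set_scope.
Local Open Scope ring_scope.

(** A ball of the truncated metric always contains the ball of the original
metric with the same radius; conversely a radius can be shrunk to at most
[2 * t], which is possible because [t] is positive, and then the truncated ball
is an original one. *)
Lemma gravitational_nbhs (R : realType) (t : R) (t0 : 0 < t)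
    (M : metricType R) (x : M) (A : set M) :
  nbhs (x : gravitational t0 M) (A : set (gravitational t0 M)) <-> nbhs x A.
Proof.
split=> /nbhs_mdistP[e /= e0 eA]; apply/nbhs_mdistP.
- exists e => //= y xy; apply: eA.
  by rewrite /= gravitational_mdistE gt_min xy orbT.
- exists (Num.min (2 * t) e) => /=; first by rewrite lt_min mulr_gt0.
  move=> y; rewrite /= gravitational_mdistE lt_min !gt_min ltxx /=.
  move=> /andP[xy]; case/orP => [te|]; last exact: eA.
  by apply: eA; exact: lt_trans te.
Qed.

Lemma gravitational_open (R : realType) (t : R) (t0 : 0 < t)
    (M : metricType R) (A : set M) :
  open (A : set (gravitational t0 M)) <-> open A.
Proof.
rewrite !openE; split=> oA x Ax; have := oA x Ax; rewrite /interior /=.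
  by move/gravitational_nbhs.
by move=> ?; exact/gravitational_nbhs.
Qed.

Lemma gravitational_dense (R : realType) (t : R) (t0 : 0 < t)
    (M : metricType R) (D : set M) :
  dense (D : set (gravitational t0 M)) <-> dense D.
Proof.
split=> dD O O0 oO; apply: (dD O O0).
  exact/gravitational_open.
by move/gravitational_open: oO.
Qed.

Theorem theorem11 (R : realType) (t : R) (t0 : 0 < t) (M : metricType R) :
  separable M <-> separable (gravitational t0 M).
Proof.
split=> -[D cD dD]; exists D => //; first exact/gravitational_dense.
by move/gravitational_dense: dD.
Qed.
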